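(* Let $\{\overline X_n\}_{n\ge0}$ be the state-independent reflecting random walk on the half-strip $S=\{0,1,2,\ldots\}\times\{1,\ldots,d\}$, i.e. with blocks $P_0$ and $(P_n,Q_n,R_n)=(P,Q,R)$ for all $n>0$, satisfying conditions $C_1$, $C_2$, $C_3$ (all as described in the context), started from layer $0$ with an initial distribution $\bar\mu$. Let $$\bar\varrho_1^{+}=\mathbf 1'P\Big(\sum_{k\ge1}(A^{-})^{k-1}\mathbf u^{-}\Big)+d .$$ Then: (1) the random walk is positive recurrent if and only if $\bar\varrho_1^{+}<\infty$; (2) denoting by $\lambda_{A^{-}}$ the maximum eigenvalue of $A^{-}$, one has $\lambda_{A^{-}}<1$ whenever $\bar\varrho_1^{+}<\infty$.
   Context: Setting: let $d\ge 1$ be an integer. $\overline X_n$, $n\ge0$, is a time-homogeneous Markov chain on $S=\{0,1,2,\ldots\}\times\{1,\ldots,d\}$; layer $n$ is $L_n=\{(n,i):1\le i\le d\}$. There are nonnegative $d\times d$ matrices $P_0,P,Q,R$ with $P_0\mathbf 1=\mathbf 1$ and $(P+Q+R)\mathbf 1=\mathbf 1$, where $\mathbf 1$ is the column vector of ones and $\mathbf 1'$ its transpose. From $(0,i)$ the chain moves to $(1,j)$ with probability $P_0(i,j)$; from $(n,i)$ with $n\ge1$ it moves to $(n+1,j)$, $(n,j)$, $(n-1,j)$ with probability $P(i,j)$, $R(i,j)$, $Q(i,j)$ respectively. Standing conditions (under which the chain is irreducible), with $\|B\|=\max_i\sum_j|b_{ij}|$: $C_1$: $\log(1-\|R+P\|)^{-1}<\infty$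 and $\log(1-\|R+Q\|)^{-1}<\infty$ (i.e. both norms are $<1$). $C_2$: for every $j$, $\sum_{i}P_0(i,j)>0$, $\sum_{i}P(i,j)>0$ and $\sum_{i}Q(i,j)>0$. $C_3$: all states of layer $0$ lie in one communication class. Definitions: let $\rho$ be a stochastic $d\times d$ matrix, $\zeta^{(0)}=\rho$ and $\zeta^{(m+1)}=(I-P\zeta^{(m)}-R)^{-1}Q$. It is part of the setting (taken as given from the literature) that $\zeta^{-}=\lim_{m\to\infty}\zeta^{(m)}$ exists; it is a stochastic matrix satisfying $\zeta^{-}=(I-P\zeta^{-}-R)^{-1}Q$. Put $$A^{-}=(I-P\zeta^{-}-R)^{-1}P,\qquad \mathbf u^{-}=(I-P\zeta^{-}-R)^{-1}\mathbf 1 .$$ The maximum eigenvalue of the nonnegative matrix $A^-$ is its spectral radius. With $T_y^{+}$ the first time $t\ge1$ at which the walk is in $L_y$, layer $y$ is called positive recurrent if the expected value of $T_y^{+}$ is finite when the walk starts in $L_y$ (from every state of $L_y$); the walk is positive recurrent if its layers are (equivalently, the irreducible chain is positive recurrent). *)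

(* Defs.v *)
From HB Require Import structures.
From mathcomp Require Import all_boot all_order all_algebra.
From mathcomp Require Import all_classical all_reals all_analysis.
From mathcomp Require Import complex.

Set Implicit Arguments.
Unset Strict Implicit.
Unset Printing Implicit Defensive.

Import Order.TTheory GRing.Theory Num.Theory.
Import numFieldNormedType.Exports.

Local Open Scope classical_set_scope.
Local Open Scope ring_scope.

Definition nonneg_mx (K : realType) (m n : nat) (A : 'M[K]_(m, n)) : Prop :=
  forall i j, 0 <= A i j.

Definition stochastic_mx (K : realType) (d : nat) (A : 'M[K]_d) : Prop :=
  nonneg_mx A /\ A *m const_mx 1 = const_mx 1 :> 'cV[K]_d.

(* The operator norm max_i sum_j |b_ij|; the library norm `|B| on matrices is
   max_ij |b_ij| instead. *)
Definition row_sum_norm (K : realType) (d : nat) (B : 'M[K]_d) : K :=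
  \big[Num.max/0]_i \sum_j `|B i j|.

(* The set of moduli is finite, and nonempty when 0 < d, so this sup is a
   maximum; it ranges over the complex eigenvalues of A. *)
Definition spectral_radius (K : realType) (d : nat) (A : 'M[K]_d) : K :=
  sup [set ComplexField.Normc.normc z
      | z in [set z : K[i] | eigenvalue (map_mx (real_complex K) A) z]].

Definition strip (d : nat) : Type := (nat * 'I_d)%type.

Definition layer (d : nat) (y : nat) : set (strip d) := [set x | x.1 = y].

Definition step_prob (K : realType) (d : nat) (P0 P Q R : 'M[K]_d)
    (x y : strip d) : K :=
  match x.1 with
  | 0%N => if y.1 == 1%N then P0 x.2 y.2 else 0
  | n.+1 => if y.1 == n.+2 then P x.2 y.2
            else if y.1 == n.+1 then R x.2 y.2
            else if y.1 == n then Q x.2 y.2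
            else 0
  end.

Definition point_law (K : realType) (d : nat) (x : strip d) (y : strip d) : K :=
  (y == x)%:R.

Definition layer0_law (K : realType) (d : nat) (mu : 'I_d -> K)
    (x : strip d) : K :=
  if x.1 == 0%N then mu x.2 else 0.

(* The state space is countable and carries the discrete sigma-algebra.  The
   last clause is P(X_(n+1) = y | X_0 = x_0, ..., X_n = x_n) = p(x_n, y),
   multiplied out by the probability of the conditioning event. *)
Definition markov_chain (K : realType) (d : nat)
    (p : strip d -> strip d -> K) (init : strip d -> K)
    (disp : measure_display) (Omega : measurableType disp)
    (Pr : probability Omega K) (X : nat -> Omega -> strip d) : Prop :=
  [/\ forall n (A : set (strip d)), measurable (X n @^-1` A),
      forall x, Pr [set w | X 0%N w = x] = (init x)%:E
    & forall (n : nat) (x : nat -> strip d),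
        Pr [set w | forall k, (k <= n.+1)%N -> X k w = x k] =
        (Pr [set w | forall k, (k <= n)%N -> X k w = x k]
         * (p (x n) (x n.+1))%:E)%E].

Definition leads_to (K : realType) (d : nat)
    (disp : measure_display) (Omega : measurableType disp)
    (Pr : strip d -> probability Omega K) (X : nat -> Omega -> strip d)
    (x y : strip d) : Prop :=
  exists n : nat, (0 < Pr x [set w | X n w = y])%E.

Definition communicate (K : realType) (d : nat)
    (disp : measure_display) (Omega : measurableType disp)
    (Pr : strip d -> probability Omega K) (X : nat -> Omega -> strip d)
    (x y : strip d) : Prop :=
  leads_to Pr X x y /\ leads_to Pr X y x.

Definition condC1 (K : realType) (d : nat) (P Q R : 'M[K]_d) : Prop :=
  row_sum_norm (R + P) < 1 /\ row_sum_norm (R + Q) < 1.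

Definition condC2 (K : realType) (d : nat) (P0 P Q : 'M[K]_d) : Prop :=
  forall j, [/\ 0 < \sum_i P0 i j, 0 < \sum_i P i j & 0 < \sum_i Q i j].

Definition condC3 (K : realType) (d : nat)
    (disp : measure_display) (Omega : measurableType disp)
    (Pr : strip d -> probability Omega K) (X : nat -> Omega -> strip d) : Prop :=
  forall i j : 'I_d, communicate Pr X (0%N, i) (0%N, j).

(* First t >= 1 with X_t in layer y; the infimum of the empty set is +oo. *)
Definition return_time (K : realType) (d : nat) (Omega : Type)
    (X : nat -> Omega -> strip d) (y : nat) (w : Omega) : \bar K :=
  ereal_inf [set (t%:R)%:E | t in [set t : nat | (1 <= t)%N /\ layer y (X t w)]].

Definition layer_positive_recurrent (K : realType) (d : nat)
    (disp : measure_display) (Omega : measurableType disp)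
    (Pr : strip d -> probability Omega K) (X : nat -> Omega -> strip d)
    (y : nat) : Prop :=
  forall x : strip d, layer y x ->
    (\int[Pr x]_w return_time K X y w < +oo)%E.

Definition positive_recurrent (K : realType) (d : nat)
    (disp : measure_display) (Omega : measurableType disp)
    (Pr : strip d -> probability Omega K) (X : nat -> Omega -> strip d) : Prop :=
  forall y : nat, layer_positive_recurrent Pr X y.

Definition zeta (K : realType) (d : nat) (P Q R rho : 'M[K]_d) (m : nat) :
    'M[K]_d :=
  iter m (fun z => invmx (1%:M - P *m z - R) *m Q) rho.

Definition A_minus (K : realType) (d : nat) (P R zm : 'M[K]_d) : 'M[K]_d :=
  invmx (1%:M - P *m zm - R) *m P.

Definition u_minus (K : realType) (d : nat) (P R zm : 'M[K]_d) : 'cV[K]_d :=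
  invmx (1%:M - P *m zm - R) *m const_mx 1.

(* 1' P (sum_(k >= 1) A^(k-1) u) + d, computed in the extended reals, the inner
   series of column vectors being taken entrywise. *)
Definition varrho1 (K : realType) (d : nat) (P A : 'M[K]_d) (u : 'cV[K]_d) :
    \bar K :=
  ((\sum_(i < d) \sum_(j < d)
     (P i j)%:E * \sum_(1 <= k <oo) ((A ^+ k.-1 *m u) j 0)%:E)
   + (d%:R)%:E)%E.

(* Main.v *)
(* Write z for the limit of the zeta iteration: a stochastic solution of
   P z^2 + R z + Q = z.  If w is a vector with w = u + A w, i.e.
   w = 1 + P w + (P z + R) w, then f(n) = (1 + z + ... + z^(n-1)) w satisfies
   E f(X_1) = f - 1 off layer 0.
   - If varrho is finite, w = sum_k A^k u is finite; f is a Lyapunov function, so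
     the layers have finite expected return times, and A w = w - u <= c w with
     c < 1 bounds the spectral radius.
   - Conversely, with the partial sums w_m = sum_(k < m) A^k u in place of w, f is
     a subsolution of linear growth.  As the walk moves at most one layer per step,
     f(1) <= E[min(T_0, t)] + C (t + 1) P(T_0 > t), and if E T_0 is finite the last
     term cannot stay bounded away from 0 (harmonic series), so w_m <= E T_0 for
     all m.
   Neither direction needs z to be the true first-passage matrix. *)
Require Import Defs.
From mathcomp Require Import all_boot all_order all_algebra.
From mathcomp Require Import all_classical all_reals all_analysis.
From mathcomp Require Import measurable_realfun complex ring lra.
Import Order.TTheory GRing.Theory Num.Theory.
Import numFieldNormedType.Exports.
Local Open Scope classical_set_scope.
Local Open Scope ring_scope.

Set Implicit Arguments.
Unset Strict Implicit.
Unset Printing Implicit Defensive.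

(** * Nonnegative matrices: inverses of 1 - M and a bound on eigenvalues *)

Section NonnegativeMatrices.
Variable K : realType.

Lemma nonneg_mxM (m n p : nat) (A : 'M[K]_(m, n)) (B : 'M[K]_(n, p)) :
  nonneg_mx A -> nonneg_mx B -> nonneg_mx (A *m B).
Proof. by move=> A0 B0 i j; rewrite mxE sumr_ge0// => k _; rewrite mulr_ge0. Qed.

Lemma nonneg_mxD (m n : nat) (A B : 'M[K]_(m, n)) :
  nonneg_mx A -> nonneg_mx B -> nonneg_mx (A + B).
Proof. by move=> A0 B0 i j; rewrite mxE addr_ge0. Qed.

Lemma ler_mulmx (m n p : nat) (A : 'M[K]_(m, n)) (B C : 'M[K]_(n, p)) :
  nonneg_mx A -> (forall i j, B i j <= C i j) ->
  forall i j, (A *m B) i j <= (A *m C) i j.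
Proof.
by move=> A0 BC i j; rewrite !mxE ler_sum// => k _; rewrite ler_wpM2l.
Qed.

Lemma nonneg_mxX (d : nat) (A : 'M[K]_d) k : nonneg_mx A -> nonneg_mx (A ^+ k).
Proof.
move=> A0; elim: k => [|k IH]; last by rewrite exprS; exact: nonneg_mxM.
by move=> i j; rewrite expr0 mxE; case: (_ == _).
Qed.

Lemma mulmx_const1 (m n : nat) (A : 'M[K]_(m, n)) i :
  (A *m (const_mx 1 : 'cV_n)) i 0 = \sum_j A i j.
Proof. by rewrite mxE; apply: eq_bigr => j _; rewrite mxE mulr1. Qed.

Lemma stochastic_mx_row_sum (d : nat) (A : 'M[K]_d) i :
  stochastic_mx A -> \sum_j A i j = 1.
Proof. by move=> [_ A1]; rewrite -mulmx_const1 A1 mxE. Qed.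

Lemma stochastic_mxX (d : nat) (A : 'M[K]_d) k :
  stochastic_mx A -> stochastic_mx (A ^+ k).
Proof.
move=> [A0 A1]; split; first exact: nonneg_mxX.
elim: k => [|k IH]; first by rewrite expr0 mul1mx.
by rewrite exprS -mulmxA IH.
Qed.

Lemma row_sum_norm_ge (d : nat) (A : 'M[K]_d) i :
  nonneg_mx A -> \sum_j A i j <= row_sum_norm A.
Proof.
move=> A0; apply: le_trans (le_bigmax _ _ i) => /=.
by rewrite le_eqVlt; apply/orP; left; apply/eqP/eq_bigr => j _; rewrite ger0_norm.
Qed.

(* Minimum principle: at an index i minimising x, the row sum condition turns
   x i < 0 into x i > (M x) i. *)
Lemma sub1_mulmx_ge0 (d : nat) (M : 'M[K]_d) (x : 'cV[K]_d) :
  nonneg_mx M -> (forall i, \sum_j M i j < 1) ->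
  (forall i, 0 <= ((1%:M - M) *m x) i 0) -> forall i, 0 <= x i 0.
Proof.
move=> M0 M1 Mx i0.
have [i _ xmin] := @arg_minP _ _ _ i0 xpredT (fun i => x i 0) isT.
apply: le_trans (xmin i0 isT); rewrite leNgt; apply/negP => xi0.
have := Mx i; rewrite mulmxBl mul1mx mxE [X in _ + X]mxE subr_ge0; apply/negP.
rewrite -ltNge; apply: (@lt_le_trans _ _ ((\sum_j M i j) * x i 0)).
  by rewrite -subr_gt0 -[X in _ - X]mul1r -mulrBl nmulr_lgt0// subr_lt0.
by rewrite mxE mulr_suml ler_sum// => j _; rewrite ler_wpM2l ?M0 ?xmin.
Qed.

(** The minimum principle applies to a kernel vector and to its negative, so the kernel is
    trivial. *)
Lemma sub1_unitmx (d : nat) (M : 'M[K]_d) :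
  nonneg_mx M -> (forall i, \sum_j M i j < 1) -> 1%:M - M \in unitmx.
Proof.
move=> M0 M1; rewrite -unitmx_tr -row_free_unit; apply: inj_row_free => v vM.
have Mv : (1%:M - M) *m v^T = 0.
  by apply: trmx_inj; rewrite trmx_mul trmxK vM trmx0.
apply: trmx_inj; apply/colP => i; rewrite trmx0 [RHS]mxE; apply/eqP.
rewrite eq_le; apply/andP; split; last first.
  by apply: (sub1_mulmx_ge0 M0 M1) => j; rewrite Mv mxE.
rewrite -oppr_ge0; have -> : - v^T i 0 = (- v^T) i 0 by rewrite [RHS]mxE.
by apply: (sub1_mulmx_ge0 M0 M1) => j; rewrite mulmxN Mv oppr0 mxE.
Qed.

(** Column j of the inverse solves (1 - M) x = e_j with e_j nonnegative, so the minimum principle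
    applies to it. *)
Lemma sub1_invmx_ge0 (d : nat) (M : 'M[K]_d) :
  nonneg_mx M -> (forall i, \sum_j M i j < 1) -> nonneg_mx (invmx (1%:M - M)).
Proof.
move=> M0 M1 i j; have MU := sub1_unitmx M0 M1.
have -> : invmx (1%:M - M) i j = col j (invmx (1%:M - M)) i 0 by rewrite mxE.
apply: (sub1_mulmx_ge0 M0 M1) => k.
rewrite colE mulKVmx// mxE; by case: (_ && _).
Qed.

Lemma cvg_mulmx (m n p : nat) (A : nat -> 'M[K]_(m, n)) (B : nat -> 'M[K]_(n, p))
    (a : 'M[K]_(m, n)) (b : 'M[K]_(n, p)) :
  (forall i j, A k i j @[k --> \oo] --> a i j) ->
  (forall i j, B k i j @[k --> \oo] --> b i j) ->
  forall i j, (A k *m B k) i j @[k --> \oo] --> (a *m b) i j.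
Proof.
move=> Aa Bb i j; rewrite mxE; under eq_fun do rewrite mxE.
apply: cvg_big => [|l _]; first exact: add_continuous.
exact: cvgM.
Qed.

(* If A v = v - u with u, v > 0, then A v <= c v for some c < 1, and testing a
   left eigenvector against v bounds the moduli of the eigenvalues by c. *)
Lemma spectral_radius_lt1 (d : nat) (A : 'M[K]_d) (u v : 'cV[K]_d) :
  nonneg_mx A -> (forall i, 0 < u i 0) -> (forall i, 0 <= v i 0) ->
  v = u + A *m v -> spectral_radius A < 1.
Proof.
move=> A0 u0 v0 vE.
have Av0 i : 0 <= (A *m v) i 0.
  by apply: nonneg_mxM => // k l; rewrite ord1.
have v_gt0 i : 0 < v i 0 by rewrite vE mxE ltr_pwDl.
pose c := \big[Num.max/0]_i (1 - u i 0 / v i 0).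
have c_lt1 : c < 1.
  by apply: bigmax_lt => // i _; rewrite ltrBlDr ltrDl divr_gt0.
have Avc i : (A *m v) i 0 <= c * v i 0.
  have -> : (A *m v) i 0 = (1 - u i 0 / v i 0) * v i 0.
    by rewrite mulrBl mul1r divfK ?gt_eqF// [in RHS]vE [in RHS]mxE addrAC subrr add0r.
  rewrite ler_wpM2r//; exact: (le_bigmax _ (fun i => 1 - u i 0 / v i 0) i).
have eig_le (z : K[i]) :
    eigenvalue (map_mx (real_complex K) A) z -> ComplexField.Normc.normc z <= c.
  case/eigenvalueP => w wA w_neq0.
  pose a i := ComplexField.Normc.normc (w 0 i).
  have a0 i : 0 <= a i by rewrite /a; case: (w 0 i) => x y; exact: sqrtr_ge0.
  have av_gt0 : 0 < \sum_j a j * v j 0.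
    have [j wj] : exists j, w 0 j != 0.
      apply/existsP; apply: contraNT w_neq0; rewrite negb_exists => /forallP w0.
      by apply/eqP/rowP => j; apply/eqP; rewrite mxE -[_ == _]negbK w0.
    apply: (@lt_le_trans _ _ (a j * v j 0)); last first.
      by rewrite (bigD1 j)//= lerDl sumr_ge0// => k _; rewrite mulr_ge0// ltW.
    rewrite mulr_gt0// lt_neqAle a0 andbT eq_sym.
    by apply: contra wj => /eqP/ComplexField.Normc.eq0_normc ->.
  have za j : ComplexField.Normc.normc z * a j <= \sum_i a i * A i j.
    rewrite /a -ComplexField.Normc.normcM.
    have <- : (w *m map_mx (real_complex K) A) 0 j = z * w 0 j by rewrite wA mxE.
    rewrite mxE; apply: (big_ind2 (fun (x : K[i]) (y : K) =>
        ComplexField.Normc.normc x <= y)) => [|x1 x2 y1 y2 h1 h2|i _].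
    - by rewrite ComplexField.Normc.normc0.
    - by apply: le_trans (le_normcD _ _) _; exact: lerD.
    - rewrite ComplexField.Normc.normcM mxE /= expr0n addr0 sqrtr_sqr.
      by rewrite ger0_norm.
  rewrite -(ler_pM2r av_gt0) mulr_sumr mulr_sumr.
  apply: (@le_trans _ _ (\sum_j (\sum_i a i * A i j) * v j 0)).
    by apply: ler_sum => j _; rewrite mulrA ler_wpM2r// ltW.
  under eq_bigr do rewrite mulr_suml.
  rewrite exchange_big/=; apply: ler_sum => i _.
  under eq_bigr do rewrite -mulrA.
  by rewrite -mulr_sumr mulrCA ler_wpM2l//; have := Avc i; rewrite mxE.
rewrite /spectral_radius.
(* For d = 0 there are no eigenvalues, and [sup] of the empty set is 0. *)
have [-> |/set0P S0] := eqVneq [set ComplexField.Normc.normc z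
      | z in [set z : K[i] | eigenvalue (map_mx (real_complex K) A) z]] set0.
  by rewrite sup0.
apply: le_lt_trans c_lt1; apply: ge_sup => // _ [z zA <-]; exact: eig_le.
Qed.

End NonnegativeMatrices.

(** * The limit of the [zeta] iteration *)

Section LimitMatrix.
Variables (K : realType) (d : nat) (P Q R : 'M[K]_d).
Hypothesis (P_ge0 : nonneg_mx P) (Q_ge0 : nonneg_mx Q) (R_ge0 : nonneg_mx R).
Hypothesis PQR1 : (P + Q + R) *m const_mx 1 = const_mx 1 :> 'cV[K]_d.
Hypothesis RP1 : row_sum_norm (R + P) < 1.

Lemma stochastic_block_ge0 (z : 'M[K]_d) :
  stochastic_mx z -> nonneg_mx (P *m z + R).
Proof. by move=> [z0 _]; apply: nonneg_mxD => //; exact: nonneg_mxM. Qed.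

(** As z 1 = 1, the row sums of P z + R are those of R + P, which C1 keeps below 1. *)
Lemma stochastic_block_sum_lt1 (z : 'M[K]_d) i :
  stochastic_mx z -> \sum_j (P *m z + R) i j < 1.
Proof.
move=> [z0 z1]; rewrite -mulmx_const1 mulmxDl -mulmxA z1 -mulmxDl mulmx_const1.
by apply: le_lt_trans RP1; rewrite addrC; apply: row_sum_norm_ge; exact: nonneg_mxD.
Qed.

Lemma block_unitmx (z : 'M[K]_d) :
  stochastic_mx z -> 1%:M - P *m z - R \in unitmx.
Proof.
move=> zS; rewrite -addrA -opprD; apply: sub1_unitmx => [|i].
  exact: stochastic_block_ge0.
exact: stochastic_block_sum_lt1.
Qed.

Lemma block_invmx_ge0 (z : 'M[K]_d) :
  stochastic_mx z -> nonneg_mx (invmx (1%:M - P *m z - R)).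
Proof.
move=> zS; rewrite -addrA -opprD; apply: sub1_invmx_ge0 => [|i].
  exact: stochastic_block_ge0.
exact: stochastic_block_sum_lt1.
Qed.

(** From z 1 = 1 and (P + Q + R) 1 = 1 follows Q 1 = (1 - P z - R) 1, so the inverse maps Q 1 back
    to 1. *)
Lemma zeta_stochastic (rho : 'M[K]_d) m :
  stochastic_mx rho -> stochastic_mx (zeta P Q R rho m).
Proof.
move=> rhoS; elim: m => [//|m zS]; rewrite /zeta iterS -/(zeta P Q R rho m).
set z := zeta _ _ _ _ _ in zS *; split.
  by apply: nonneg_mxM => //; exact: block_invmx_ge0.
have Q1 : Q *m const_mx 1 = (1%:M - P *m z - R) *m (const_mx 1 : 'cV[K]_d).
  rewrite !mulmxBl -mulmxA zS.2 mul1mx -[X in _ = X - _ - _]PQR1 !mulmxDl.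
  by apply/matrixP => i j; rewrite !mxE; ring.
by rewrite -mulmxA Q1 mulKmx ?block_unitmx.
Qed.

Variables (rho zm : 'M[K]_d).
Hypotheses (rhoS : stochastic_mx rho) (zmP : zeta P Q R rho @ \oo --> zm).

Let zetaP i j : zeta P Q R rho m i j @[m --> \oo] --> zm i j.
Proof. exact: cvg_comp zmP (@coord_continuous _ _ _ i j zm). Qed.

Lemma zeta_limit_stochastic : stochastic_mx zm.
Proof.
split=> [i j|].
  rewrite -(cvg_lim _ (@zetaP i j))//; apply: limr_ge.
    by apply/cvg_ex; exists (zm i j).
  by apply: nearW => m; exact: (zeta_stochastic m rhoS).1.
apply/matrixP => i j.
have : (zeta P Q R rho m *m const_mx 1 : 'cV[K]_d) i j @[m --> \oo]
    --> (zm *m const_mx 1 : 'cV[K]_d) i j.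
  by apply: cvg_mulmx => k l; [exact: zetaP | exact: cvg_cst].
under eq_fun do rewrite (zeta_stochastic _ rhoS).2.
by move/(cvg_lim (@norm_hausdorff _ _)) => <-; rewrite lim_cst.
Qed.

(** Cleared of the inverse, the recursion reads z_{m+1} = P z_m z_{m+1} + R z_{m+1} + Q, and
    products of matrices pass to the limit entrywise. *)
Lemma zeta_limit_fixpoint : P *m (zm *m zm) + R *m zm + Q = zm.
Proof.
have E m : P *m (zeta P Q R rho m *m zeta P Q R rho m.+1)
    + R *m zeta P Q R rho m.+1 + Q = zeta P Q R rho m.+1.
  have U := block_unitmx (zeta_stochastic m rhoS).
  have : (1%:M - P *m zeta P Q R rho m - R) *m zeta P Q R rho m.+1 = Q.
    by rewrite /zeta iterS mulKVmx.
  move: (zeta P Q R rho m.+1) (zeta P Q R rho m) => z1 z0 /esym {1}->.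
  by rewrite !mulmxBl mul1mx -mulmxA -[_ - _ - _]addrA -opprD subrKC.
have zS i j : zeta P Q R rho m.+1 i j @[m --> \oo] --> zm i j.
  by rewrite (cvg_shiftS (fun m => zeta P Q R rho m i j)).
apply/matrixP => i j.
have hP : (P *m (zeta P Q R rho m *m zeta P Q R rho m.+1)) i j @[m --> \oo]
    --> (P *m (zm *m zm)) i j.
  apply: cvg_mulmx => k l; first exact: cvg_cst.
  by apply: cvg_mulmx => k' l'; [exact: zetaP | exact: zS].
have hR : (R *m zeta P Q R rho m.+1) i j @[m --> \oo] --> (R *m zm) i j.
  by apply: cvg_mulmx => k l; [exact: cvg_cst | exact: zS].
have h : zeta P Q R rho m.+1 i j @[m --> \oo]
    --> (P *m (zm *m zm) + R *m zm + Q) i j.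
  have -> : (fun m => zeta P Q R rho m.+1 i j) = fun m =>
      (P *m (zeta P Q R rho m *m zeta P Q R rho m.+1)) i j
      + (R *m zeta P Q R rho m.+1) i j + Q i j.
    by apply/funext => m; rewrite -[in LHS]E 2!mxE.
  have -> : (P *m (zm *m zm) + R *m zm + Q) i j
      = (P *m (zm *m zm)) i j + (R *m zm) i j + Q i j by rewrite 2!mxE.
  exact: cvgD (cvgD hP hR) (cvg_cst _).
by rewrite -(cvg_lim (@norm_hausdorff _ _) h) (cvg_lim (@norm_hausdorff _ _) (@zS i j)).
Qed.

End LimitMatrix.

Lemma nneseries_ltyP (K : realType) (a : nat -> K) : (forall n, 0 <= a n) ->
  (\sum_(0 <= k <oo) (a k)%:E < +oo)%E <->
  exists B, forall n, \sum_(k < n) a k <= B.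
Proof.
move=> a0; split=> [a_fin|[B aB]].
  exists (fine (\sum_(0 <= k <oo) (a k)%:E)%E) => n.
  rewrite -lee_fin fineK; last first.
    by rewrite ge0_fin_numE// nneseries_ge0// => k _ _; rewrite lee_fin.
  rewrite -sumEFin -(big_mkord xpredT (fun k => (a k)%:E)).
  by apply: nneseries_lim_ge => k _ _; rewrite lee_fin.
apply: (@le_lt_trans _ _ B%:E); last exact: ltry.
apply: lime_le; first by apply: is_cvg_nneseries => k _ _; rewrite lee_fin.
by apply: nearW => n; rewrite big_mkord sumEFin lee_fin.
Qed.

(** * The transition operator and its sub- and supersolutions *)

Section Walk.
Variables (K : realType) (d : nat) (P0 P Q R : 'M[K]_d).
Hypothesis (P0_ge0 : nonneg_mx P0) (P_ge0 : nonneg_mx P).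
Hypothesis (Q_ge0 : nonneg_mx Q) (R_ge0 : nonneg_mx R).
Implicit Types (C : K) (f g h : nat -> 'cV[K]_d) (v : 'cV[K]_d) (z : 'M[K]_d).

(* A function on the strip is given by its column vectors on the layers; this is
   the transition operator g |-> (x |-> E_x[g(X_1)]). *)
Definition walk_step g (n : nat) : 'cV[K]_d :=
  if n is m.+1 then P *m g m.+2 + R *m g m.+1 + Q *m g m else P0 *m g 1.

(** Zeroing layer y before a step kills the walk on arrival there, while the starting point may
    still lie in layer y. *)
Definition off_layer (y : nat) g (n : nat) : 'cV[K]_d := if n == y then 0 else g n.

(* Entry i of survival y t n is the probability, from (n, i), that layer y is not
   visited at the times 1, ..., t. *)
Definition survival (y t : nat) : nat -> 'cV[K]_d :=
  iter t (fun g => walk_step (off_layer y g)) (fun=> const_mx 1).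

(** A step climbs at most one layer, so the comparison is asked only up to layer n + 1. This
    restriction is what lets the error term n + t of [subsolution_le] survive the induction. *)
Lemma walk_step_le g h n : (forall m i, (m <= n.+1)%N -> g m i 0 <= h m i 0) ->
  forall i, walk_step g n i 0 <= walk_step h n i 0.
Proof.
move=> gh i; case: n gh => [|n] gh /=.
  by apply: ler_mulmx => // k j; rewrite ord1 gh.
by rewrite !(mxE, lerD)//; do ?[apply: lerD]; apply: ler_sum => j _;
  rewrite ler_wpM2l// gh// ltnW.
Qed.

Lemma walk_stepD g h n :
  walk_step (fun m => g m + h m) n = walk_step g n + walk_step h n.
Proof.
case: n => [|n] /=; rewrite !mulmxDr//.
by rewrite [RHS]addrACA; congr (_ + _); rewrite addrACA.
Qed.

Lemma walk_stepZ (c : K) g n : walk_step (fun m => c *: g m) n = c *: walk_step g n.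
Proof. by case: n => [|n] /=; rewrite -!scalemxAr// !scalerDr. Qed.

Lemma walk_step_sum t (g : nat -> nat -> 'cV[K]_d) n :
  walk_step (fun m => \sum_(s < t) g s m) n = \sum_(s < t) walk_step (g s) n.
Proof. by case: n => [|n] /=; rewrite !mulmx_sumr// !big_split. Qed.

Lemma survival_ge0 y t n i : 0 <= survival y t n i 0.
Proof.
elim: t n i => [|t IH] n i; first by rewrite mxE.
have -> : 0 = walk_step (fun=> 0) n i 0 :> K.
  by case: n => [|n] /=; rewrite !mulmx0 ?addr0 mxE.
apply: walk_step_le => m j _; rewrite /off_layer; case: eqP => _ //.
by rewrite mxE.
Qed.

Lemma off_survival_ge0 y t n i : 0 <= off_layer y (survival y t) n i 0.
Proof. by rewrite /off_layer; case: eqP => _; [rewrite mxE | exact: survival_ge0]. Qed.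

(** First-step equation: the sum over s < t of P(T_y > s) is E[min(T_y, t)], where T_y is the first
    return time. *)
Lemma sum_survivalS y t n :
  \sum_(s < t.+1) survival y s n =
  const_mx 1 + walk_step (fun m => \sum_(s < t) off_layer y (survival y s) m) n.
Proof.
rewrite big_ord_recl; congr (_ + _); apply/esym.
exact: (walk_step_sum t (fun s => off_layer y (survival y s))).
Qed.

Lemma sum_off_survival y t n : n <> y ->
  \sum_(s < t) off_layer y (survival y s) n = \sum_(s < t) survival y s n.
Proof. by move=> ny; apply: eq_bigr => s _; rewrite /off_layer; case: eqP. Qed.

(** Drift criterion. By induction on the truncation, V dominates the truncated hitting times of y
    off layer y. One further step from an arbitrary layer, y included, bounds the return time. *)
Lemma sum_survival_le y (V : nat -> 'cV[K]_d) :
  (forall n i, 0 <= V n i 0) ->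
  (forall n i, n <> y -> 1 + walk_step V n i 0 <= V n i 0) ->
  forall t n i, (\sum_(s < t) survival y s n) i 0 <= 1 + walk_step V n i 0.
Proof.
move=> V0 VV t n i.
have HV s m j : (\sum_(r < s) off_layer y (survival y r) m) j 0 <= V m j 0.
  elim: s m j => [|s IH] m j; first by rewrite big_ord0 mxE.
  have [->|/eqP my] := eqVneq m y.
    by rewrite summxE big1// => r _; rewrite /off_layer eqxx mxE.
  rewrite sum_off_survival// sum_survivalS 2!mxE.
  apply: le_trans (VV _ _ my); rewrite lerD2l.
  by apply: walk_step_le => k l _; exact: IH.
apply: (@le_trans _ _ ((\sum_(s < t.+1) survival y s n) i 0)).
  by rewrite big_ord_recr [leRHS]mxE lerDl survival_ge0.
rewrite sum_survivalS 2!mxE lerD2l.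
by apply: walk_step_le => k l _; exact: HV.
Qed.

(* A function of linear growth with f <= 1 + E f off layer 0 is below the truncated
   expected hitting times of layer 0 up to an error C (n + t) P(T_0 > t): the walk
   gains at most one layer per step. *)
Lemma subsolution_le f C :
  f 0 = 0 -> (forall n i, f n i 0 <= C * n%:R) -> 0 <= C ->
  (forall n i, f n.+1 i 0 <= 1 + walk_step f n.+1 i 0) ->
  forall t n i, f n i 0 <= (\sum_(s < t) off_layer 0 (survival 0 s) n) i 0
    + C * (n + t)%:R * off_layer 0 (survival 0 t) n i 0.
Proof.
move=> f0 fC C0 fstep; elim=> [|t IH] [|n] i.
- by rewrite f0 /off_layer eqxx big_ord0 !mxE mulr0 addr0.
- by rewrite big_ord0 /off_layer /= !mxE add0r addn0 mulr1.
- rewrite f0 summxE big1 => [|s _]; last by rewrite /off_layer mxE.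
  by rewrite /off_layer !mxE mulr0 addr0.
rewrite sum_off_survival// sum_survivalS 2!mxE.
apply: le_trans (fstep n i) _; rewrite -addrA lerD2l.
set S := off_layer 0 (survival 0 t).
rewrite -[off_layer 0 _ n.+1]/(walk_step S n.+1).
have -> : C * (n.+1 + t.+1)%:R * (walk_step S n.+1) i 0 =
    walk_step (fun m => (C * (n.+1 + t.+1)%:R) *: S m) n.+1 i 0.
  by rewrite walk_stepZ [RHS]mxE.
have E (a b : 'cV[K]_d) : a i 0 + b i 0 = (a + b) i 0 by rewrite mxE.
rewrite E -walk_stepD; apply: walk_step_le => m j mn.
apply: le_trans (IH m j) _; rewrite mxE [in leRHS]mxE lerD2l.
by rewrite ler_wpM2r ?off_survival_ge0// ler_wpM2l// ler_nat addnS -addSn leq_add2r.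
Qed.

Definition geometric_sum z v (n : nat) : 'cV[K]_d := \sum_(k < n) z ^+ k *m v.

Lemma geometric_sumS z v n : geometric_sum z v n.+1 = v + z *m geometric_sum z v n.
Proof.
rewrite /geometric_sum big_ord_recl expr0 mul1mx mulmx_sumr; congr (_ + _).
by apply: eq_bigr => k _; rewrite exprS -mulmxA.
Qed.

(** With w the value at layer n, the layers n + 1 and n + 2 carry v + z w and v + z v + z^2 w. The
    quadratic equation collapses the terms in w to z w, which is the value at n + 1 minus v. *)
Lemma walk_step_geometric_sum z v n : P *m (z *m z) + R *m z + Q = z ->
  walk_step (geometric_sum z v) n.+1 =
  geometric_sum z v n.+1 + (P *m (v + z *m v) + R *m v - v).
Proof.
move=> zE; rewrite /= !geometric_sumS.
move: (geometric_sum z v n) => w.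
rewrite -[in X in _ = v + X + _]zE !mulmxDr !mulmxDl !mulmxA.
by apply/matrixP => i j; rewrite !mxE; ring.
Qed.

Lemma geometric_sum_ge0 z v n i : nonneg_mx z -> (forall j, 0 <= v j 0) ->
  0 <= geometric_sum z v n i 0.
Proof.
move=> z0 v0; rewrite summxE sumr_ge0// => k _.
by apply: nonneg_mxM; [exact: nonneg_mxX | move=> j l; rewrite ord1].
Qed.

Lemma geometric_sum_le z v C n i : stochastic_mx z -> (forall j, v j 0 <= C) ->
  geometric_sum z v n i 0 <= C * n%:R.
Proof.
move=> zS vC; rewrite summxE -[n in n%:R]card_ord -sum1_card natr_sum mulr_sumr.
apply: ler_sum => k _; have [zk0 zk1] := stochastic_mxX k zS.
apply: (@le_trans _ _ ((z ^+ k *m const_mx C) i 0)).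
  by apply: ler_mulmx => // j l; rewrite ord1 mxE.
have -> : const_mx C = C *: const_mx 1 :> 'cV[K]_d.
  by apply/matrixP => j l; rewrite !mxE mulr1.
by rewrite -scalemxAr zk1 !mxE.
Qed.

End Walk.

(** * Return times of the chain expressed through [survival] *)

Section MarkovChain.
Variables (K : realType) (d : nat) (P0 P Q R : 'M[K]_d).
Hypothesis (P0_ge0 : nonneg_mx P0) (P_ge0 : nonneg_mx P).
Hypothesis (Q_ge0 : nonneg_mx Q) (R_ge0 : nonneg_mx R).

Lemma step_prob_ge0 x y : 0 <= step_prob P0 P Q R x y.
Proof. by rewrite /step_prob; case: x.1 => [|n]; do ?case: ifP. Qed.

Lemma step_prob_series (g : nat -> 'cV[K]_d) x : (forall n i, 0 <= g n i 0) ->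
  (\sum_(0 <= m <oo) (\sum_j step_prob P0 P Q R x (m, j) * g m j 0)%:E)%E =
  (walk_step P0 P Q R g x.1 x.2 0)%:E.
Proof.
move=> g0; case: x => n i.
have s0 m : 0 <= \sum_j step_prob P0 P Q R (n, i) (m, j) * g m j 0.
  by rewrite sumr_ge0// => j _; rewrite mulr_ge0// step_prob_ge0.
(* From layer n only layers up to n + 1 are reachable, so the tail from n + 2 on vanishes. *)
rewrite (nneseries_split 0 n.+2) => [|k _]; last by rewrite lee_fin.
rewrite eseries0 => [|m nm _]; last first.
  rewrite add0n in nm; rewrite big1// => j _; rewrite /step_prob /=.
  case: n nm {s0} => [|n] nm; first by rewrite gtn_eqF// mul0r.
  by rewrite !gtn_eqF ?mul0r//; do ![exact: ltnW | apply: ltnW].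
rewrite adde0 add0n sumEFin; congr (_%:E).
case: n {s0} => [|n].
  by rewrite big_nat_recr//= big_nat1 big1 => [|j _]; rewrite ?mul0r// add0r mxE.
rewrite big_nat_recr//= big_nat_recr//= big_nat_recr//= big1_seq => [|m]; last first.
  rewrite mem_index_iota => /= nm; rewrite big1// => j _; rewrite /step_prob /=.
  by rewrite !ltn_eqF ?mul0r//; do ![exact: leqW | apply: leqW].
have rev (a b c : K) : a + b + c = c + b + a by ring.
rewrite add0r rev !mxE /step_prob /= eqxx; congr (_ + _ + _).
  by apply: eq_bigr => j _; rewrite (@ltn_eqF n.+1 n.+2)// eqxx.
by apply: eq_bigr => j _; rewrite (@ltn_eqF n n.+2)// (@ltn_eqF n n.+1)// eqxx.
Qed.

Variables (disp : measure_display) (Omega : measurableType disp).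
Variable X : nat -> Omega -> strip d.

Definition path_event (n : nat) (x : nat -> strip d) : set Omega :=
  [set w | forall k, (k <= n)%N -> X k w = x k].

(** The window starts strictly after time n, so that for n = 0 this is the event that the first
    return comes after time t. *)
Definition avoid_event (y n t : nat) : set Omega :=
  [set w | forall s, (n < s <= n + t)%N -> (X s w).1 <> y].

(** Tail formula: T is the sum over t of the indicators of T > t. When the layer is never revisited,
    both sides are infinite. *)
Lemma return_time_series y w :
  return_time K X y w = (\sum_(0 <= t <oo) (\1_(avoid_event y 0 t) w)%:E)%E.
Proof.
have i0 t : (0 <= (\1_(avoid_event y 0 t) w)%:E :> \bar K)%E by rewrite lee_fin.
have [[t0 ht0]|nohit] := pselect (exists t, (0 < t)%N && ((X t w).1 == y)).
  have hit : exists t, (0 < t)%N && ((X t w).1 == y) by exists t0.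
  case: (ex_minnP hit) => t /andP[t_gt0 /eqP Xt] tmin.
  rewrite (nneseries_split 0 t)// eseries0 => [|s ts _]; last first.
    rewrite indicE memNset// => /(_ t); rewrite t_gt0 !add0n in ts *.
    by move=> /(_ ts); apply.
  rewrite adde0 add0n big_nat (eq_bigr (fun=> 1%:E)) => [|s /= st]; last first.
    rewrite indicE mem_set// => r /andP[r_gt0 rs] Xr.
    have := tmin r; rewrite r_gt0 Xr eqxx => /(_ isT).
    by rewrite leqNgt (leq_ltn_trans rs).
  rewrite -big_nat sumEFin sumr_const_nat subn0.
  apply/eqP; rewrite eq_le; apply/andP; split.
    by apply: ereal_inf_lbound; exists t.
  apply/ereal_infP => _ [s [s_gt0 Xs] <-].
  by rewrite lee_fin ler_nat tmin// s_gt0 Xs eqxx.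
have -> : return_time K X y w = +oo%E.
  rewrite /return_time; set S := (X in ereal_inf X).
  suff -> : S = set0 by rewrite ereal_inf0.
  apply/seteqP; split => // z [t [t_gt0 Xt] _]; apply: nohit.
  by exists t; rewrite t_gt0 Xt eqxx.
apply/esym/eqyP => A A0.
have [n An] : exists n : nat, A <= n%:R.
  by exists (Num.bound A); exact/ltW/archi_boundP/ltW.
apply: (@le_trans _ _ (\sum_(0 <= t < n) (\1_(avoid_event y 0 t) w)%:E)%E); last first.
  exact: nneseries_lim_ge.
rewrite (eq_bigr (fun=> 1%:E)) => [|t _].
  by rewrite sumEFin sumr_const_nat subn0 lee_fin.
rewrite indicE mem_set// => s /andP[s_gt0 _] Xs; apply: nohit.
by exists s; rewrite s_gt0 Xs eqxx.
Qed.

Variable Pr : probability Omega K.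

Section Chain.
Variable init : strip d -> K.
Hypothesis Xmarkov : markov_chain (step_prob P0 P Q R) init Pr X.

Let measurable_X n A : measurable (X n @^-1` A).
Proof. by case: Xmarkov => mX _ _; exact: mX. Qed.

Lemma measurable_path_event n x : measurable (path_event n x).
Proof.
have -> : path_event n x =
    \bigcap_(k in [set k | (k <= n)%N]) (X k @^-1` [set x k]) by [].
by apply: bigcap_measurableType => k _; exact: measurable_X.
Qed.

Lemma measurable_avoid_event y n t : measurable (avoid_event y n t).
Proof.
have -> : avoid_event y n t =
    \bigcap_(s in [set s | (n < s <= n + t)%N]) (X s @^-1` [set z | z.1 <> y]) by [].
by apply: bigcap_measurableType => k _; exact: measurable_X.
Qed.

Lemma probability_partition n (B : set Omega) : measurable B ->
  Pr B = (\sum_(0 <= m <oo) \sum_j Pr (B `&` X n @^-1` [set (m, j)]))%E.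
Proof.
move=> mB.
have mBn m j : measurable (B `&` X n @^-1` [set (m, j)]) by exact: measurableI.
have BE : B = \bigcup_m (B `&` X n @^-1` [set z | z.1 = m]).
  by apply/seteqP; split=> [w Bw|w [m _ []//]]; exists (X n w).1.
rewrite [in LHS]BE measure_bigcup//=; last 2 first.
- by move=> m _; exact: measurableI.
- by move=> m k _ _ [w [[_ /= <-] [_ /= <-]]].
rewrite (eq_eseriesl (Q := xpredT)); last by move=> m; rewrite in_setT.
apply: eq_eseriesr => m _.
have -> : B `&` X n @^-1` [set z | z.1 = m] =
    \big[setU/set0]_(j < d) (B `&` X n @^-1` [set (m, j)]).
  rewrite -bigcup_seq; apply/seteqP; split=> w; last by move=> [j _ [Bw /= ->]].
  move=> [Bw /= <-]; exists (X n w).2; first exact: mem_index_enum.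
  by split=> //=; exact: surjective_pairing.
rewrite measure_bigsetU_ord// => j k _ _ [w [[_ /= ->] [_ /= [->]]]] //.
Qed.

(** Markov property for a finite window, by induction on t with n and the path free: split on the
    state at time n + 1 and append it to the path, which costs one transition factor. *)
Lemma path_avoid_probability y t n x :
  Pr (path_event n x `&` avoid_event y n t) =
  (Pr (path_event n x) * (survival P0 P Q R y t (x n).1 (x n).2 0)%:E)%E.
Proof.
elim: t n x => [|t IH] n x.
  rewrite mxE mule1; congr (Pr _); apply/setIidPl => w _ s.
  by rewrite addn0 => /andP[ns /(leq_trans ns)]; rewrite ltnn.
rewrite (probability_partition n.+1); last first.
  by apply: measurableI; [exact: measurable_path_event | exact: measurable_avoid_event].
have [c cE] : exists c, Pr (path_event n x) = c%:E.
  exists (fine (Pr (path_event n x))); rewrite fineK// fin_num_measure//.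
  exact: measurable_path_event.
have c0 : 0 <= c by rewrite -lee_fin -cE.
rewrite -[survival _ _ _ _ _ _ _]/(walk_step P0 P Q R
  (off_layer y (survival P0 P Q R y t)) (x n).1).
rewrite -(step_prob_series (x n)) => [|m i]; last exact: off_survival_ge0.
rewrite cE -nneseriesZl => [|m _]; last first.
  rewrite lee_fin sumr_ge0// => j _.
  by rewrite mulr_ge0 ?step_prob_ge0 ?off_survival_ge0.
apply: eq_eseriesr => m _.
rewrite -EFinM mulr_sumr -sumEFin; apply: eq_bigr => j _.
(* A next state in layer y contributes zero on both sides: the event is empty and [off_layer]
   vanishes. *)
have [->|/eqP my] := eqVneq m y.
  rewrite /off_layer eqxx mxE !mulr0 (_ : _ `&` _ = set0) ?measure0//.
  apply/seteqP; split=> // w [[_ /(_ n.+1)]]; rewrite ltnS leqnn addnS ltnS leq_addr.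
  by move=> /(_ isT) + /= => /[swap] ->.
(* Only the values of [x'] up to time n + 1 matter. *)
pose x' k := if (k <= n)%N then x k else (m, j).
have -> : path_event n x `&` avoid_event y n t.+1 `&` X n.+1 @^-1` [set (m, j)] =
    path_event n.+1 x' `&` avoid_event y n.+1 t.
  apply/seteqP; split=> w.
    move=> [[xw aw] /= Xw]; split=> [k|s /andP[ns st]]; rewrite /x'.
      by rewrite leq_eqVlt ltnS => /orP[/eqP->|kn]; rewrite ?ltnn// kn xw.
    by apply: aw; rewrite ltnW// addnS -addSn.
  move=> [xw aw]; have Xw : X n.+1 w = (m, j) by rewrite xw// /x' ltnn.
  split=> //; split=> [k kn|s]; first by rewrite xw ?leqW// /x' kn.
  rewrite leq_eqVlt => /andP[/orP[/eqP<- _|ns st]]; first by rewrite Xw.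
  by apply: aw; rewrite ns addSn -addnS.
have x'n : x' n = x n by rewrite /x' leqnn.
have x'Sn : x' n.+1 = (m, j) by rewrite /x' ltnn.
rewrite IH x'Sn; case: Xmarkov => _ _ /(_ n x'); rewrite -/(path_event n.+1 x') => ->.
rewrite -/(path_event n x') x'n x'Sn.
have -> : path_event n x' = path_event n x.
  by apply/seteqP; split=> w xw k kn; rewrite xw// /x' kn.
rewrite cE -!EFinM mulrA; congr ((_ * _)%:E).
by rewrite /off_layer; case: eqP.
Qed.

End Chain.

(** The tail formula is integrated term by term, and each avoidance event is then intersected with
    the almost sure event that the chain starts at x. *)
Lemma expected_return_time y (x : strip d) :
  markov_chain (step_prob P0 P Q R) (point_law K x) Pr X ->
  (\int[Pr]_w return_time K X y w)%E =
  (\sum_(0 <= t <oo) (survival P0 P Q R y t x.1 x.2 0)%:E)%E.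
Proof.
move=> XM; under eq_integral do rewrite return_time_series.
have mA t : measurable (avoid_event y 0 t) by exact: (measurable_avoid_event XM).
rewrite integral_nneseries//; last first.
  by move=> t; apply/measurable_EFinP; exact: measurable_indic.
apply: eq_eseriesr => t _; rewrite integral_indic// setIT.
have X0 : Pr (path_event 0 (fun=> x)) = 1%E.
  case: XM => _ /(_ x) + _; rewrite /point_law eqxx => <-; congr (Pr _).
  apply/seteqP; split=> w /=; first exact.
  by move=> Xw k; rewrite leqn0 => /eqP ->.
rewrite -[RHS]mul1e -X0 -(path_avoid_probability XM).
have [mp ma] := (measurable_path_event XM 0 (fun=> x), measurable_avoid_event XM y 0 t).
have C0 : Pr (~` path_event 0 (fun=> x)) = 0%E.
  by rewrite probability_setC// X0 subee.
have D0 : Pr (avoid_event y 0 t `\` path_event 0 (fun=> x)) = 0%E.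
  by apply: (subset_measure0 (measurableD ma mp) (measurableC mp) _ C0) => w [].
by rewrite (measureDI Pr ma mp) setIC [X in (X + _)%E]D0 add0e.
Qed.

End MarkovChain.

Lemma finite_uniform_bound (K : realType) (I : finType) (F : nat -> I -> K) :
  (forall i, exists B, forall n, F n i <= B) -> exists B, forall n i, F n i <= B.
Proof.
move=> /choice[b Fb]; exists (\big[Num.max/0]_i b i) => n i.
exact: le_trans (Fb i n) (le_bigmax _ _ i).
Qed.

Lemma harmonic_sum_unbounded (K : realType) (B : K) :
  exists n, B < \sum_(k < n) harmonic k.
Proof.
apply/not_existsP => hB; apply: (@dvg_harmonic K).
apply: nondecreasing_is_cvgn.
  apply/nondecreasing_seqP => n; rewrite /series /= big_nat_recr//= lerDl.
  exact: harmonic_ge0.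
exists B => _ [n _ <-]; rewrite /series /= big_mkord leNgt.
by apply/negP => /hB.
Qed.

(** * Finiteness of [varrho1] against summability of [survival] *)

Section Criterion.
Variables (K : realType) (d : nat) (P0 P Q R z : 'M[K]_d).
Hypothesis (P0S : stochastic_mx P0).
Hypothesis (P_ge0 : nonneg_mx P) (Q_ge0 : nonneg_mx Q) (R_ge0 : nonneg_mx R).
Hypothesis (PQR1 : (P + Q + R) *m const_mx 1 = const_mx 1 :> 'cV[K]_d).
Hypothesis (RP1 : row_sum_norm (R + P) < 1) (RQ1 : row_sum_norm (R + Q) < 1).
Hypothesis (P0_col : forall j, 0 < \sum_i P0 i j).
Hypothesis (P_col : forall j, 0 < \sum_i P i j).
Hypothesis (zS : stochastic_mx z) (zE : P *m (z *m z) + R *m z + Q = z).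

Let A := A_minus P R z.
Let u := u_minus P R z.
Let N := invmx (1%:M - P *m z - R).
Let P0_ge0 : nonneg_mx P0. Proof. by case: P0S. Qed.
Let z_ge0 : nonneg_mx z. Proof. by case: zS. Qed.
Let NU : 1%:M - P *m z - R \in unitmx. Proof. exact: block_unitmx. Qed.
Let N_ge0 : nonneg_mx N. Proof. exact: block_invmx_ge0. Qed.
Let A_ge0 : nonneg_mx A. Proof. exact: nonneg_mxM. Qed.

(** By its definition u = 1 + (P z + R) u, and u is nonnegative. *)
Let u_ge1 i : 1 <= u i 0.
Proof.
have u0 : nonneg_mx u by apply: nonneg_mxM => // k l; rewrite mxE.
have -> : u = const_mx 1 + (P *m z + R) *m u.
  have : (1%:M - P *m z - R) *m u = const_mx 1 by rewrite /u /u_minus mulKVmx.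
  by rewrite !mulmxBl mul1mx mulmxDl => <-; rewrite -[_ - _ - _]addrA -opprD subrK.
rewrite mxE [const_mx _ _ _]mxE lerDl.
by apply: nonneg_mxM => //; apply: nonneg_mxD => //; exact: nonneg_mxM.
Qed.

Let v m : 'cV[K]_d := \sum_(k < m) A ^+ k *m u.

(** By conversion, [v m] is [geometric_sum A u m]. *)
Let vS m : v m.+1 = u + A *m v m. Proof. exact: geometric_sumS. Qed.

Let Aku_ge0 k i : 0 <= (A ^+ k *m u) i 0.
Proof.
apply: nonneg_mxM; first exact: nonneg_mxX.
by move=> j l; rewrite ord1 (le_trans ler01).
Qed.

Let v_ge0 m i : 0 <= v m i 0.
Proof. by rewrite summxE sumr_ge0. Qed.

Let v_le m i : v m i 0 <= v m.+1 i 0.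
Proof. by rewrite /v big_ord_recr /= [leRHS]mxE lerDl. Qed.

Let series_shift j : (\sum_(1 <= k <oo) ((A ^+ k.-1 *m u) j 0)%:E)%E =
  (\sum_(0 <= k <oo) ((A ^+ k *m u) j 0)%:E)%E.
Proof.
rewrite -(nneseries_addn 1) => [|k]; last first.
  by rewrite lee_fin; exact: Aku_ge0.
by apply: eq_eseriesr => k _; rewrite addn1.
Qed.

(** By C2 every column j of P has a positive entry, so an infinite series in coordinate j would make
    [varrho1] infinite. *)
Lemma varrho1_ltyP : (varrho1 P A u < +oo)%E <->
  exists B, forall m i, v m i 0 <= B.
Proof.
have vE j m : v m j 0 = \sum_(k < m) (A ^+ k *m u) j 0 by rewrite summxE.
pose S j := (\sum_(1 <= k <oo) ((A ^+ k.-1 *m u) j 0)%:E)%E.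
have S0 j : (0 <= S j)%E by apply: nneseries_ge0 => k _ _; rewrite lee_fin.
have PS0 i j : (0 <= (P i j)%:E * S j)%E by rewrite mule_ge0// lee_fin.
have SP j : (S j < +oo)%E <-> exists B, forall m, v m j 0 <= B.
  rewrite /S series_shift nneseries_ltyP//.
  by split=> -[B hB]; exists B => m; have := hB m; rewrite vE.
split=> [rho_fin|[B vB]]; last first.
  apply: lte_add_pinfty; last exact: ltry.
  apply: lte_sum_pinfty => i _; apply: lte_sum_pinfty => j _.
  by apply: lte_mul_pinfty; rewrite ?lee_fin//; apply/SP; exists B.
apply: finite_uniform_bound => j; apply/SP.
have [i Pij] : exists i, 0 < P i j.
  apply/not_existsP => Pj; have := P_col j; rewrite big1 ?ltxx// => i _.
  by apply/eqP; rewrite eq_le P_ge0 leNgt andbT; apply/negP => /Pj.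
have : ((P i j)%:E * S j < +oo)%E.
  apply: le_lt_trans rho_fin; rewrite /varrho1 -/S (bigD1 i)//= (bigD1 j)//=.
  have G k (p : pred 'I_d) : (0 <= \sum_(l | p l) (P k l)%:E * S l)%E.
    by apply: sume_ge0 => l _; exact: PS0.
  rewrite -addeA -addeA leeDl//; apply: adde_ge0; first exact: G.
  apply: adde_ge0; last by rewrite lee_fin.
  by apply: sume_ge0 => k _; exact: (G k xpredT).
by rewrite !ltey; apply: contra => /eqP ->; rewrite gt0_muley ?lte_fin.
Qed.

(** The partial sums [v m] increase and are bounded; w is their limit, and the equation is the limit
    of [vS]. *)
Let hitting_vector : (varrho1 P A u < +oo)%E ->
  exists2 w : 'cV[K]_d, forall i, 0 <= w i 0 & w = u + A *m w.
Proof.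
move=> /varrho1_ltyP[B vB].
pose w : 'cV[K]_d := \col_j limn (fun m => v m j 0).
have vw i j : v m i j @[m --> \oo] --> w i j.
  rewrite (ord1 j) mxE; apply: nondecreasing_is_cvgn.
    by apply/nondecreasing_seqP => m; exact: v_le.
  by exists B => _ [m _ <-]; exact: vB.
exists w => [i|].
  rewrite -(cvg_lim (@norm_hausdorff _ _) (@vw i 0)); apply: limr_ge.
    by apply/cvg_ex; exists (w i 0); exact: vw.
  exact: nearW.
apply/matrixP => i j.
have vSw : v m.+1 i j @[m --> \oo] --> w i j.
  by rewrite (cvg_shiftS (fun m => v m i j)); exact: vw.
have Avw : (A *m v m) i j @[m --> \oo] --> (A *m w) i j.
  by apply: cvg_mulmx => k l; [exact: cvg_cst | exact: vw].
have h : v m.+1 i j @[m --> \oo] --> (u + A *m w) i j.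
  have -> : (fun m => v m.+1 i j) = fun m => u i j + (A *m v m) i j.
    by apply/funext => m; rewrite vS [LHS]mxE.
  by rewrite [X in _ --> X]mxE; exact: cvgD (cvg_cst _) Avw.
by rewrite -(cvg_lim (@norm_hausdorff _ _) h) (cvg_lim (@norm_hausdorff _ _) vSw).
Qed.

(* First-step equation of N (1 + P w), w in the role of the expected time to descend
   one layer. *)
Let block_eq (w w' : 'cV[K]_d) : w' = u + A *m w ->
  w' = const_mx 1 + P *m w + (P *m z + R) *m w'.
Proof.
move=> wE.
have : (1%:M - P *m z - R) *m w' = const_mx 1 + P *m w.
  by rewrite wE /A /u /A_minus /u_minus -mulmxA -mulmxDr mulKVmx.
by rewrite !mulmxBl mul1mx mulmxDl => <-; rewrite -[_ - _ - _]addrA -opprD subrK.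
Qed.

Lemma spectral_radius_A_minus : (varrho1 P A u < +oo)%E -> spectral_radius A < 1.
Proof.
move=> /hitting_vector[w w0 wE].
by apply: spectral_radius_lt1 w0 wE => // i; exact: lt_le_trans (u_ge1 i).
Qed.

Lemma survival_summable_of_varrho1 : (varrho1 P A u < +oo)%E ->
  forall y i, (\sum_(0 <= t <oo) (survival P0 P Q R y t y i 0)%:E < +oo)%E.
Proof.
move=> /hitting_vector[w w0 /block_eq wE] y i.
apply/nneseries_ltyP => [t|]; first exact: survival_ge0.
have RQ_ge0 : nonneg_mx (R + Q) by exact: nonneg_mxD.
(* By C1, e is a positive lower bound on the probability of going up from any state off layer 0. *)
pose e := 1 - row_sum_norm (R + Q).
have e_gt0 : 0 < e by rewrite subr_gt0.
have row_sum1 k : \sum_j P k j + \sum_j R k j + \sum_j Q k j = 1.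
  have /colP/(_ k) := PQR1; rewrite mulmx_const1 mxE => <-.
  by rewrite -!big_split; apply: eq_bigr => j _; rewrite !mxE addrAC.
have eP k : e <= \sum_j P k j.
  rewrite /e lerBlDr -(row_sum1 k) -addrA lerD2l.
  apply: le_trans (row_sum_norm_ge k RQ_ge0).
  by rewrite -big_split ler_sum// => j _; rewrite mxE.
have Rk k : 0 <= \sum_j R k j by rewrite sumr_ge0.
have Qk k : 0 <= \sum_j Q k j by rewrite sumr_ge0.
have e_le1 : e <= 1.
  by have := eP i; have := row_sum1 i; have := Rk i; have := Qk i; lra.
pose M := 2 / e.
have eM : e * M = 2 by rewrite mulrC divfK ?gt_eqF.
have M2 : 2 <= M by rewrite ler_pdivlMr// ler_piMr.
have M_ge1 : 1 <= M by apply: le_trans M2; rewrite ler1n.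
have mul_const (B : 'M[K]_d) c k : (B *m const_mx c : 'cV_d) k 0 = c * \sum_j B k j.
  by rewrite mxE mulr_sumr; apply: eq_bigr => j _; rewrite mxE mulrC.
(* Lyapunov function with drift at most -1 off layer y: above y it is the sum
   sum_k z^k w of the times to descend one layer; below y, going up has probability
   at least e = 2 / M, which makes 2 (M^y - M^n) decrease fast enough. *)
pose V n : 'cV[K]_d :=
  if (n <= y)%N then const_mx (2 * (M ^+ y - M ^+ n)) else geometric_sum z w (n - y).
have V_below n : (n <= y)%N -> V n = const_mx (2 * (M ^+ y - M ^+ n)).
  by rewrite /V => ->.
(* The case n = 0 is included: at layer y both formulas vanish, so the step from y + 1 down to y
   obeys the formula for the upper part. *)
have V_above n : V (n + y)%N = geometric_sum z w n.
  case: n => [|n]; last by rewrite /V leqNgt addSn ltnS leq_addl -addSn addnK.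
  rewrite V_below// subrr mulr0 /geometric_sum big_ord0.
  by apply/matrixP => k l; rewrite !mxE.
have V_ge0 n k : 0 <= V n k 0.
  rewrite /V; case: leqP => ny; last exact: geometric_sum_ge0.
  by rewrite mxE mulr_ge0// subr_ge0 ler_weXn2l.
exists (1 + walk_step P0 P Q R V y i 0) => t; rewrite -summxE.
apply: sum_survival_le => // n k ny.
have [{ny} ny|yn|//] := ltngtP n y.
  case: n ny => [|n] ny.
    rewrite /= !V_below ?leq0n// mul_const stochastic_mx_row_sum// mulr1 mxE.
    rewrite expr0 expr1.
    by move: M2; lra.
  rewrite /= (@V_below n.+2 ny) (@V_below n.+1 (ltnW ny)).
  rewrite (@V_below n (ltnW (ltnW ny))).
  rewrite 2!mxE !mul_const [leRHS]mxE !exprS.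
  move: (row_sum1 k) (eP k) (Rk k) (Qk k).
  have: 1 <= M ^+ n by exact: exprn_ege1.
  move: (M ^+ n) (M ^+ y) (\sum_j P k j) (\sum_j R k j) (\sum_j Q k j).
  move=> x X p r q x1 prq ep r0 q0.
  have -> : r = 1 - p - q by rewrite -prq; ring.
  have pM : 2 <= p * M by rewrite -eM ler_wpM2r// (le_trans ler01).
  have q1 : q <= 1 by lra.
  (* With p + q + r = 1, the drift of V at this layer is exactly -2 x (M - 1) (p M - q). *)
  have : 1 <= x * (M - 1) * (p * M - q).
    rewrite -[leLHS]mulr1; apply: ler_pM => //; last lra.
    by rewrite -[leLHS]mulr1; apply: ler_pM => //; lra.
  nra.
have [m nE] : exists m, n = (m.+1 + y)%N.
  by exists (n - y).-1; rewrite prednK ?subnK ?subn_gt0// ltnW.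
rewrite nE V_above.
have -> : walk_step P0 P Q R V (m.+1 + y) = walk_step P0 P Q R (geometric_sum z w) m.+1.
  by rewrite /= -!V_above.
rewrite walk_step_geometric_sum//.
have -> : P *m (w + z *m w) + R *m w - w = - const_mx 1.
  rewrite [in X in _ - X]wE mulmxDr mulmxDl mulmxA; apply/matrixP => a b.
  by rewrite !mxE; ring.
by rewrite [X in 1 + X]mxE [X in _ + (_ + X)]mxE [X in _ - X]mxE addrC subrK.
Qed.

Lemma varrho1_of_survival_summable :
  (forall i, (\sum_(0 <= t <oo) (survival P0 P Q R 0 t 0 i 0)%:E < +oo)%E) ->
  (varrho1 P A u < +oo)%E.
Proof.
move=> surv_fin; apply/varrho1_ltyP.
pose S t i := survival P0 P Q R 0 t 1 i 0.
have S0 t i : 0 <= S t i by exact: survival_ge0.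
(* By C2 each state j of layer 1 is entered from some state of layer 0 with positive probability, so
   summability transfers from layer 0 to layer 1. *)
have [B SB] : exists B, forall t j, \sum_(s < t) S s j <= B.
  apply: finite_uniform_bound => j.
  have [i Pij] : exists i, 0 < P0 i j.
    apply/not_existsP => Pj; have := P0_col j; rewrite big1 ?ltxx// => i _.
    by apply/eqP; rewrite eq_le P0_ge0 leNgt andbT; apply/negP => /Pj.
  have /nneseries_ltyP[t|B hB] := surv_fin i; first exact: survival_ge0.
  exists (B / P0 i j) => t; rewrite ler_pdivlMr// mulr_suml.
  apply: le_trans (hB t.+1); rewrite big_ord_recl mxE -[leLHS]add0r lerD//.
  apply: ler_sum => s _; rewrite [leRHS]mxE (bigD1 j)//= mulrC lerDl.
  by rewrite sumr_ge0// => k _; rewrite mulr_ge0// survival_ge0.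
exists B => m i; apply: le_trans (v_le m i) _; rewrite leNgt; apply/negP => Bv.
(* Here [v m] and [v m.+1] play the roles of w and w'. *)
have vE := block_eq (vS m).
pose f := geometric_sum z (v m.+1).
pose C := \sum_j v m.+1 j 0.
have C0 : 0 <= C by rewrite sumr_ge0.
have vC j : v m.+1 j 0 <= C by rewrite /C (bigD1 j)//= lerDl sumr_ge0.
(* The drift of f is -1 + P (v_{m+1} - v_m), hence at least -1 by monotonicity of the partial
   sums. *)
have f_step n j : f n.+1 j 0 <= 1 + walk_step P0 P Q R f n.+1 j 0.
  rewrite walk_step_geometric_sum//.
  have -> : P *m (v m.+1 + z *m v m.+1) + R *m v m.+1 - v m.+1 =
      P *m v m.+1 - P *m v m - const_mx 1.
    rewrite [in X in _ - X = _]vE mulmxDr mulmxDl mulmxA; apply/matrixP => a b.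
    by rewrite !mxE; ring.
  have : (P *m v m) j 0 <= (P *m v m.+1) j 0.
    by apply: ler_mulmx => // k l; rewrite ord1; exact: v_le.
  rewrite [X in _ -> _ <= 1 + X]mxE; move: (P *m v m) (P *m v m.+1) => a b ab.
  by rewrite -/f !mxE; move: ab; lra.
have f1 : f 1 = v m.+1 by rewrite /f /geometric_sum big_ord1 expr0 mul1mx.
(* [subsolution_le] is read at layer 1, where f is [v m.+1] and the truncated hitting times are at
   most B. *)
have key t : v m.+1 i 0 - B <= C * t.+1%:R * S t i.
  have := subsolution_le P0_ge0 P_ge0 Q_ge0 R_ge0 _ _ C0 f_step t 1 i.
  rewrite f1 sum_off_survival// => h; rewrite lerBlDl.
  apply: le_trans (h _ _) _ => [|n j|]; [by rewrite /f /geometric_sum big_ord0| |].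
    exact: geometric_sum_le.
  by rewrite add1n; apply: lerD => //; rewrite summxE; exact: SB.
have C_gt0 : 0 < C.
  rewrite lt_neqAle C0 andbT; apply/eqP => CE; have := key 0%N.
  by rewrite -CE !mul0r subr_le0 leNgt Bv.
pose D := v m.+1 i 0 - B.
have D_gt0 : 0 < D by rewrite subr_gt0.
(* Dividing [key] by t + 1 and summing gives D times the harmonic sum at most C B, against the
   choice of n. *)
have [n] := harmonic_sum_unbounded (B * C / D).
apply/negP; rewrite -leNgt ler_pdivlMr// mulr_suml.
apply: le_trans (ler_wpM2r C0 (SB n i)); rewrite mulr_suml.
apply: ler_sum => t _; rewrite /harmonic mulrC ler_pdivrMr//.
by rewrite (_ : _ * _ * _ = C * t.+1%:R * S t i)//; ring.
Qed.

End Criterion.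

Theorem corollary1p3
  (K : realType) (d : nat) (hd : (1 <= d)%N)
  (P0 P Q R : 'M[K]_d)
  (hP0 : stochastic_mx P0)
  (hP : nonneg_mx P) (hQ : nonneg_mx Q) (hR : nonneg_mx R)
  (hPQR : (P + Q + R) *m const_mx 1 = const_mx 1 :> 'cV[K]_d)
  (disp : measure_display) (Omega : measurableType disp)
  (X : nat -> Omega -> strip d)
  (Pr : strip d -> probability Omega K)
  (hPr : forall x : strip d,
     markov_chain (step_prob P0 P Q R) (point_law K x) (Pr x) X)
  (mu : 'I_d -> K)
  (hmu0 : forall i, 0 <= mu i) (hmu1 : \sum_i mu i = 1)
  (Prmu : probability Omega K)
  (hPrmu : markov_chain (step_prob P0 P Q R) (layer0_law mu) Prmu X)
  (hC1 : condC1 P Q R) (hC2 : condC2 P0 P Q) (hC3 : condC3 Pr X)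
  (rho zm : 'M[K]_d) (hrho : stochastic_mx rho)
  (hzm : zeta P Q R rho @ \oo --> zm) :
  (positive_recurrent Pr X <->
     (varrho1 P (A_minus P R zm) (u_minus P R zm) < +oo)%E)
  /\
  ((varrho1 P (A_minus P R zm) (u_minus P R zm) < +oo)%E ->
     spectral_radius (A_minus P R zm) < 1).
Proof.
have P0_ge0 : nonneg_mx P0 by case: hP0.
have [RP1 RQ1] := hC1.
have P0_col j : 0 < \sum_i P0 i j by case: (hC2 j).
have P_col j : 0 < \sum_i P i j by case: (hC2 j).
have zmS := zeta_limit_stochastic hP hQ hR hPQR RP1 hrho hzm.
have zmE := zeta_limit_fixpoint hP hQ hR hPQR RP1 hrho hzm.
split; last exact: (spectral_radius_A_minus hP hR RP1 P_col zmS).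
split=> [PR|rho_fin y x xy].
  apply: (varrho1_of_survival_summable hP0 hP hQ hR RP1 P0_col P_col zmS zmE) => i.
  rewrite -(expected_return_time P0_ge0 hP hQ hR 0 (hPr (0%N, i))).
  exact: PR.
rewrite (expected_return_time P0_ge0 hP hQ hR y (hPr x)) xy.
exact: (survival_summable_of_varrho1 hP0 hP hQ hR hPQR RP1 RQ1 P_col zmS zmE).
Qed.
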